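(* Let $p \geq 11$ be a prime. Then for every real number $n \geq 2p$, \[\Phi(n,p) \geq \left\lfloor \frac{2n}{p} \right\rfloor + 1.\]
   Context: For real numbers $x$ and $y$, $\Phi(x,y)$ denotes the number of positive integers at most $x$ having no prime factor less than $y$ (in particular the integer $1$ is counted). *)

(* Defs.v *)
From HB Require Import structures.
From mathcomp Require Import all_boot all_order all_algebra.
From mathcomp Require Import reals.
Set Implicit Arguments. Unset Strict Implicit. Unset Printing Implicit Defensive.
Import Order.TTheory GRing.Theory Num.Theory.
Local Open Scope ring_scope.

Definition no_prime_factor_lt (R : realType) (y : R) (k : nat) : bool :=
  all (fun q : nat => ~~ (q%:R < y)) (primes k).

(* [Num.truncn x] is the integer part of [x] when [0 <= x] and [0] otherwise,
   so [iota 1 (Num.truncn x)] lists the positive integers at most [x]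
   (see [mem_iota_truncn]). *)
Definition Phi (R : realType) (x y : R) : nat :=
  count (no_prime_factor_lt y) (iota 1 (Num.truncn x)).

Lemma mem_iota_truncn (R : realType) (x : R) (k : nat) :
  (k \in iota 1 (Num.truncn x)) = (0 < k)%N && (k%:R <= x).
Proof.
by rewrite mem_iota add1n ltnS; case: k => [//|k] /=; rewrite truncn_gt_nat.
Qed.

Lemma no_prime_factor_ltP (R : realType) (y : R) (k : nat) : (0 < k)%N ->
  reflect (forall q : nat, prime q -> (q %| k)%N -> ~ (q%:R < y))
          (no_prime_factor_lt y k).
Proof.
move=> k0; apply: (iffP allP) => [h q pq qk|h q].
  by apply/negP/h; rewrite mem_primes pq k0.
by rewrite mem_primes => /and3P[pq _ qk]; apply/negP/h.
Qed.

(* Main.v *)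
Require Import Defs.
From Stdlib Require Import PeanoNat.
From HB Require Import structures.
From mathcomp Require Import all_boot all_order all_algebra zify ring lra.
From mathcomp Require Import reals.
Set Implicit Arguments. Unset Strict Implicit. Unset Printing Implicit Defensive.
Import Order.TTheory GRing.Theory Num.Theory.

(** Write [N] for the integer part of [n]; one has to show that more than
    [(2N + 1) / p] of the integers up to [N] have no prime factor below [p].

    The sieve bound is Legendre's: iterating Buchstab's identity from the exact
    count modulo 30 gives at least [W N - 2^e] such integers, where
    [W = prod_(q < p) (1 - 1/q)] and [e] is the number of primes in [[7, p)].
    Since [p W] is at least 5/2 from [p = 11] on and 9/2 from [p = 29] on, this
    settles all [N] above roughly [2 p 2^e] (for [p >= 29], [2 p 2^e / 5]).

    For smaller [N] the primes in [[p, N]] suffice: by computation below 4096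
    (below 128 for [p = 11] and [p = 13], where the sieve already takes over),
    and beyond that, where the failure of the sieve forces [log2 N < 3p/8], by
    Erdos' argument.  With [2m ~ N], every prime power in ['C(2m, m)] is at most
    [2m], primes above [sqrt(2m)] occur at most once, and primes below [p] but
    above [2m/3] do not occur, so [4^m / (2m)] is at most [4^min(p, 2m/3)] times
    a power of [2m] whose exponent is [sqrt(2m)] plus the number of primes in
    [[p, N]]. *)

(** * Rough numbers and primes in intervals *)

Definition rough (p k : nat) : bool := all (leq p) (primes k).

Definition rough_count (p N : nat) : nat := count (rough p) (iota 1 N).

Definition prime_count (a b : nat) : nat := count prime (index_iota a b).

Definition primorial (n : nat) : nat := \prod_(0 <= q < n.+1 | prime q) q.

Lemma prime_count_cat (a b c : nat) : a <= b -> b <= c ->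
  prime_count a c = prime_count a b + prime_count b c.
Proof.
move=> ab bc; rewrite /prime_count -count_cat /index_iota.
by rewrite -{2}(subnKC ab) -iotaD; congr (count _ (iota _ _)); lia.
Qed.

Lemma prime_countS (a b : nat) : a <= b ->
  prime_count a b.+1 = prime_count a b + prime b.
Proof.
move=> ab; rewrite (prime_count_cat ab (leqnSn b)); congr (_ + _).
by rewrite /prime_count /index_iota subSnn /= addn0.
Qed.

Lemma leq_prime_count (a : nat) : {homo prime_count a : b c / b <= c}.
Proof.
move=> b c bc; have [ab|ba] := leqP a b.
  by rewrite (prime_count_cat ab bc) leq_addr.
by rewrite /prime_count /index_iota (_ : b - a = 0) //; lia.
Qed.

Lemma rough_prime (p q : nat) : prime q -> rough p q = (p <= q).
Proof. by move=> q_pr; rewrite /rough primes_prime //= andbT. Qed.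

Lemma roughM (p a b : nat) : 0 < a -> 0 < b ->
  rough p (a * b) = rough p a && rough p b.
Proof.
move=> a_gt0 b_gt0; rewrite /rough -all_cat; apply: eq_all_r => q.
by rewrite mem_cat primesM.
Qed.

Lemma roughS (p k : nat) : 0 < k ->
  rough p.+1 k = rough p k && ~~ (prime p && (p %| k)).
Proof.
move=> k_gt0; have -> : prime p && (p %| k) = (p \in primes k).
  by rewrite mem_primes k_gt0.
rewrite -has_pred1 -all_predC -all_predI.
by apply: eq_all => q /=; rewrite ltn_neqAle eq_sym andbC.
Qed.

Lemma primorial_gt0 (n : nat) : 0 < primorial n.
Proof. by apply: prodn_cond_gt0 => q /prime_gt0. Qed.

Lemma mem_primes_primorial (n q : nat) :
  (q \in primes (primorial n)) = prime q && (q <= n).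
Proof.
rewrite mem_primes primorial_gt0 /=; apply: andb_id2l => q_pr.
rewrite Euclid_dvd_prod // big_has_cond; apply/hasP/idP => [[r]|q_n].
  rewrite mem_index_iota /= => r_n /andP[r_pr].
  by rewrite dvdn_prime2 // => /eqP ->.
by exists q; rewrite ?mem_index_iota //= q_pr dvdnn.
Qed.

Lemma rough_coprime (p k : nat) : 0 < k ->
  rough p.+1 k = coprime (primorial p) k.
Proof.
move=> k_gt0; rewrite coprime_has_primes ?primorial_gt0 // -all_predC.
apply: eq_in_all => q.
by rewrite /= mem_primes_primorial mem_primes => /and3P[-> _ _]; rewrite ltnNge.
Qed.

Lemma rough_countS (p N : nat) :
  rough_count p N.+1 = rough_count p N + rough p N.+1.
Proof.
by rewrite /rough_count -[in LHS](addn1 N) iotaD count_cat /= addn0 add1n.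
Qed.

Lemma prime_count_lt_rough_count (p N : nat) : 0 < p -> 0 < N ->
  prime_count p N.+1 < rough_count p N.
Proof.
move=> p_gt0 N_gt0; rewrite /prime_count /rough_count -!size_filter.
set s := filter prime _; rewrite -[(size s).+1]/(size (1 :: s)).
apply: uniq_leq_size => [|q].
  by rewrite /= mem_filter filter_uniq ?iota_uniq.
rewrite in_cons mem_filter mem_filter mem_iota mem_index_iota.
case/predU1P=> [->|/and3P[q_pr p_q q_N]]; first by rewrite ltnS.
by rewrite rough_prime // p_q prime_gt0.
Qed.

(* Buchstab's identity: the [q]-rough multiples of [q] are the products of [q]
   with a [q]-rough number. *)
Lemma rough_count_prime_split (q N : nat) : prime q ->
  rough_count q N = rough_count q.+1 N + rough_count q (N %/ q).
Proof.
move=> q_pr; have q_gt0 := prime_gt0 q_pr.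
elim: N => [|N IHN]; first by rewrite div0n.
rewrite !rough_countS {}IHN divnS // roughS // q_pr /=.
case: (boolP (q %| N.+1)) => [q_N|_] /=; last by rewrite andbT add0n addnAC.
have -> : N.+1 = (N %/ q).+1 * q by rewrite -(divnK q_N) divnS // q_N.
rewrite add1n rough_countS roughM // (rough_prime q q_pr) leqnn andbT andbF.
by lia.
Qed.

Lemma rough_count_not_prime (q N : nat) : ~~ prime q ->
  rough_count q.+1 N = rough_count q N.
Proof.
move=> /negPf qNpr; apply: eq_in_count => k; rewrite mem_iota => /andP[k_gt0 _].
by rewrite roughS // qNpr andbT.
Qed.

Lemma rough_count_period (p N : nat) (P := primorial p) :
  rough_count p.+1 N = N %/ P * rough_count p.+1 P + rough_count p.+1 (N %% P).
Proof.
rewrite {1}(divn_eq N P); elim: (N %/ P) => [|c IHc]; first by rewrite !mul0n.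
rewrite !mulSn -!addnA -{}IHc /rough_count iotaD count_cat; congr (_ + _).
rewrite addnC iotaDl count_map; apply: eq_in_count => k.
rewrite mem_iota => /andP[k_gt0 _] /=.
rewrite !rough_coprime ?addn_gt0 ?k_gt0 ?orbT //.
by rewrite -coprime_modr modnDl coprime_modr.
Qed.

Lemma primorial6 : primorial 6 = 30.
Proof. by rewrite /primorial unlock. Qed.

Lemma rough_count7_bounds (N : nat) :
  15 * rough_count 7 N <= 4 * N + 14 /\ 4 * N <= 15 * rough_count 7 N + 10.
Proof.
have period : rough_count 7 30 = 8 by vm_compute.
have one_period :
    all (fun r => (15 * rough_count 7 r <= 4 * r + 14) &&
                  (4 * r <= 15 * rough_count 7 r + 10)) (iota 0 30).
  by vm_compute.
have r_lt : N %% 30 < 30 by rewrite ltn_mod.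
have /allP/(_ (N %% 30)) := one_period; rewrite mem_iota => /(_ r_lt)/andP[].
by rewrite (rough_count_period 6 N) primorial6 period; lia.
Qed.

Lemma prime_count7_le (p : nat) : 6 < p -> 15 * prime_count 7 p <= 4 * p - 5.
Proof.
move=> p_gt6; have [upper _] := rough_count7_bounds p.-1.
have := @prime_count_lt_rough_count 7 p.-1 isT; rewrite prednK; lia.
Qed.

(** * Small intervals by computation *)

Definition prime_pi_table (T : nat) : seq nat :=
  0 :: scanl (fun c q => c + prime q) 0 (iota 0 T).

Lemma nth_prime_pi_table (T n : nat) : n <= T ->
  nth 0 (prime_pi_table T) n = prime_count 0 n.
Proof.
case: n => [//|n] n_lt; rewrite [LHS]/= nth_scanl ?size_iota // take_iota.
rewrite (minn_idPl n_lt) /prime_count /index_iota subn0.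
have foldlE s c : foldl (fun c q => c + prime q) c s = c + count prime s.
  by elim: s c => [|q s IHs] c /=; rewrite ?addn0 // IHs addnA.
by rewrite foldlE.
Qed.

(* For [p = 11] and [p = 13] the interval [[p, N]] has too few primes well
   before [N] reaches 4096. *)
Definition computed_range (p : nat) : nat := if p < 17 then 128 else 4096.

(* [(2N + 1) %/ p] first reaches [k] at [N = (k * p)./2], so that only these [N]
   need to be tested. *)
Lemma prime_count_half_multiple_check : let table := prime_pi_table 4096 in
  all (fun p => all (fun k => k + nth 0 table p <= nth 0 table (k * p)./2.+1)
                    (iota 4 (2 * computed_range p %/ p - 3)))
      [seq p <- iota 11 (2048 - 11) | prime p].
Proof. by vm_compute. Qed.

Lemma prime_count_half_multiple (p k : nat) : prime p -> 11 <= p -> 4 <= k ->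
  k * p < 2 * computed_range p -> k <= prime_count p (k * p)./2.+1.
Proof.
move=> p_pr p_ge k_ge kp.
have range_le : computed_range p <= 4096 by rewrite /computed_range; case: ifP.
have p_lt : p < 2048 by nia.
have p_half : p <= (k * p)./2.+1 by nia.
have k_quot : k <= 2 * computed_range p %/ p by rewrite leq_divRL; lia.
have /allP/(_ p) := prime_count_half_multiple_check.
rewrite mem_filter p_pr mem_iota => /(_ _)/allP/(_ k).
rewrite mem_iota !nth_prime_pi_table; [|lia..].
rewrite (prime_count_cat (leq0n p) p_half) [k + _]addnC leq_add2l.
by apply; lia.
Qed.

Lemma prime_count_gt_small (p N : nat) : prime p -> 11 <= p -> 2 * p <= N ->
  N < computed_range p -> 2 * N + 1 < p * (prime_count p N.+1).+1.
Proof.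
move=> p_pr p_ge N_ge N_lt; set k := (2 * N + 1) %/ p.
have kp : k * p <= 2 * N + 1 := leq_divM _ _.
have k_ge : 4 <= k by rewrite leq_divRL; lia.
have k_le : k <= prime_count p N.+1.
  apply: leq_trans (prime_count_half_multiple p_pr p_ge k_ge _) _; first lia.
  by apply: leq_prime_count; lia.
have N_lt_k : 2 * N + 1 < k.+1 * p by apply: ltn_ceil; lia.
by rewrite [p * _]mulnC (leq_trans N_lt_k) // leq_mul2r ltnS k_le orbT.
Qed.

(** * Primes from the central binomial coefficient *)

Lemma sum_leq_indicator_le (n t : nat) : \sum_(1 <= k < n) (k <= t) <= t.
Proof.
rewrite -big_mkcond /= sum1_count -size_filter -[leqRHS](size_iota 1).
apply: uniq_leq_size => [|k]; first by rewrite filter_uniq ?iota_uniq.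
by rewrite mem_filter mem_index_iota mem_iota; lia.
Qed.

Lemma logn_fact_widen (q n N : nat) : prime q -> n <= N ->
  logn q n`! = \sum_(1 <= k < N.+1) n %/ q ^ k.
Proof.
move=> q_pr n_N; rewrite logn_fact // [RHS](@big_cat_nat _ _ _ n.+1) //=.
rewrite [X in _ + X]big1_seq ?addn0 // => k.
rewrite mem_index_iota => /and3P[_ n_k _].
by rewrite divn_small // (leq_trans n_k) // ltnW // ltn_expl // prime_gt1.
Qed.

(* Kummer's theorem: the summand is the carry out of the [k]-th digit when [m]
   and [n - m] are added in base [q]. *)
Lemma logn_bin (q n m : nat) : prime q -> m <= n ->
  logn q 'C(n, m) =
  \sum_(1 <= k < n.+1) (q ^ k <= m %% q ^ k + (n - m) %% q ^ k).
Proof.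
move=> q_pr m_n; apply/eqP.
rewrite -(eqn_add2r (logn q m`! + logn q (n - m)`!)).
rewrite -!lognM ?muln_gt0 ?fact_gt0 ?bin_gt0 // bin_fact // lognM ?fact_gt0 //.
rewrite (logn_fact_widen q_pr m_n) (logn_fact_widen q_pr (leq_subr m n)).
rewrite logn_fact // addnC -!big_split /=.
apply/eqP; apply: eq_bigr => k _; rewrite -divnD ?expn_gt0 ?prime_gt0 //.
by rewrite subnKC.
Qed.

Lemma logn_bin_le (q n m : nat) : prime q -> m <= n ->
  logn q 'C(n, m) <= trunc_log q n.
Proof.
move=> q_pr m_n; rewrite logn_bin //; have q_gt1 := prime_gt1 q_pr.
apply: leq_trans (sum_leq_indicator_le n.+1 _); apply: leq_sum => k _.
case: (leqP _ (_ + _)) => // carry.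
rewrite lt0b; apply: trunc_log_max => //; apply: leq_trans carry _.
by rewrite -[leqRHS](subnKC m_n) leq_add ?leq_mod.
Qed.

Lemma partn_bin_le (q n m : nat) : prime q -> 0 < n -> m <= n ->
  'C(n, m)`_q <= n.
Proof.
move=> q_pr n_gt0 m_n; rewrite p_part.
apply: leq_trans (trunc_logP (prime_gt1 q_pr) n_gt0).
by rewrite leq_exp2l ?prime_gt1 ?logn_bin_le.
Qed.

Lemma partn_bin_le_prime (q n m : nat) : prime q -> m <= n -> n < q ^ 2 ->
  'C(n, m)`_q <= q.
Proof.
move=> q_pr m_n n_lt; have q_gt1 := prime_gt1 q_pr.
have [n_eq0|n_gt0] := posnP n.
  by move: m_n; rewrite n_eq0 leqn0 => /eqP->; rewrite bin0 partn1 prime_gt0.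
rewrite p_part -[leqRHS]expn1 leq_exp2l //.
apply: leq_trans (logn_bin_le q_pr m_n) _.
rewrite -ltnS -(ltn_exp2l _ _ q_gt1).
exact: leq_ltn_trans (trunc_logP q_gt1 n_gt0) n_lt.
Qed.

(* Adding [m] to itself in base [q] produces no carry. *)
Lemma partn_central_bin_eq1 (q m : nat) : prime q -> 2 < q -> q <= m ->
  2 * m < 3 * q -> 'C(2 * m, m)`_q = 1.
Proof.
move=> q_pr q_gt2 q_le q_gt; rewrite p_part logn_bin; [|by []|lia].
rewrite (_ : 2 * m - m = m); last lia.
rewrite big1_seq // => -[|[|k]]; rewrite mem_index_iota //= => _.
  rewrite expn1 -(subnK q_le) modnDr modn_small; lia.
have q2_le : q * q <= q ^ k.+2 by rewrite mulnn leq_pexp2l; lia.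
have q_sq : 3 * q <= q * q by rewrite leq_mul2r q_gt2 orbT.
by rewrite modn_small; lia.
Qed.

Lemma bin_prod_partn (n m : nat) : m <= n ->
  'C(n, m) = \prod_(0 <= q < n.+1 | prime q) 'C(n, m)`_q.
Proof.
move=> m_n; have C_gt0 : 0 < 'C(n, m) by rewrite bin_gt0.
have partn_eq1 q : n < q -> q ^ logn q 'C(n, m) = 1.
  move=> n_q; have [q_pr|/negPf qNpr] := boolP (prime q); last first.
    by rewrite lognE qNpr.
  have log_eq0 : trunc_log q n = 0 by apply/eqP; rewrite trunc_log_eq0; lia.
  by have := logn_bin_le q_pr m_n; rewrite log_eq0 leqn0 => /eqP->.
rewrite -{1}(partnT C_gt0) (widen_partn _ (leq_addl n _)).
rewrite (@big_cat_nat _ _ _ n.+1) ?ltnS ?leq_addr //=.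
rewrite [X in _ * X]big1_seq ?muln1 => [|q] //; last first.
  by rewrite mem_index_iota => /and3P[_ /partn_eq1].
rewrite [RHS]big_mkcond; apply: eq_bigr => q _; rewrite p_part.
by case: ifP => // qNpr; rewrite lognE qNpr.
Qed.

Lemma prime_dvd_fact (q n : nat) : prime q -> (q %| n`!) = (q <= n).
Proof.
move=> q_pr; apply/idP/idP => [|q_n]; last by rewrite dvdn_fact ?prime_gt0.
rewrite fact_prod Euclid_dvd_prod // big_has => /hasP[r].
by rewrite mem_index_iota => /andP[r_gt0 r_n] /(dvdn_leq r_gt0)/leq_trans->.
Qed.

Lemma prime_dvd_bin_large (q n m : nat) :
  prime q -> m < q -> n - m < q -> q <= n -> q %| 'C(n, m).
Proof.
move=> q_pr m_q nm_q q_n; have m_n : m <= n by lia.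
have : q %| n`! by rewrite prime_dvd_fact.
rewrite -(bin_fact m_n) !Euclid_dvdM // !prime_dvd_fact //.
by rewrite [q <= m]leqNgt m_q [q <= n - m]leqNgt nm_q !orbF.
Qed.

Lemma leq_prod_primes (s : seq nat) (n : nat) : 0 < n -> uniq s ->
  {in s, forall q, prime q -> q %| n} -> \prod_(q <- s | prime q) q <= n.
Proof.
move=> n_gt0 s_uniq s_n; apply: dvdn_leq => //.
apply: (introT (unstable.Gauss_dvd_prod _ _)) s_n; rewrite map_id.
apply: (sub_in_pairwise (r := [rel x y | x != y])) (filter_all prime s) _.
  by move=> q r q_pr r_pr /= q_r; rewrite prime_coprime // dvdn_prime2.
by rewrite -uniq_pairwise filter_uniq.
Qed.

Lemma bin_middle_odd_le (m : nat) : 'C(2 * m + 1, m) <= 4 ^ m.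
Proof.
have m_lt : m < (2 * m + 1).+1 by lia.
have mS_lt : m.+1 < (2 * m + 1).+1 by lia.
have sum_bin : 2 ^ (2 * m + 1) = \sum_(i < (2 * m + 1).+1) 'C(2 * m + 1, i).
  by rewrite (expnDn 1 1); apply: eq_bigr => i _; rewrite !exp1n !muln1.
have middle_sym : 'C(2 * m + 1, m.+1) = 'C(2 * m + 1, m).
  by rewrite -bin_sub; [congr 'C(_, _)|]; lia.
move: sum_bin; rewrite (bigD1 (Ordinal m_lt)) //=.
rewrite (bigD1 (Ordinal mS_lt)) /=; last first.
  by rewrite -val_eqE /=; lia.
rewrite middle_sym expnD expnM; move: (_ ^ m) => E; lia.
Qed.

Lemma leq_primorial (n : nat) : primorial n <= 4 ^ n.
Proof.
elim/ltn_ind: n => n IHn; have [n_le2|n_gt2] := leqP n 2.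
  by case: n n_le2 {IHn} => [|[|[|//]]] _; rewrite /primorial unlock.
have [n_odd|n_even] := boolP (odd n); last first.
  have nNpr : prime n = false by apply/negP => /even_prime[|]; lia.
  have -> : primorial n = primorial n.-1.
    rewrite /primorial big_mkcond big_nat_recr //= nNpr muln1 -big_mkcond /=.
    by rewrite prednK //; lia.
  by rewrite (leq_trans (IHn _ _)) ?leq_pexp2l //; lia.
have [m nE] : exists m, n = 2 * m + 1 by exists n./2; lia.
rewrite /primorial (@big_cat_nat _ _ _ m.+2) //=; last lia.
rewrite nE [X in 4 ^ X](_ : _ = m.+1 + m) ?expnD; last lia.
rewrite leq_mul ?IHn //; first lia.
apply: leq_trans (bin_middle_odd_le m).
apply: leq_prod_primes => [||q]; [by rewrite bin_gt0; lia|exact: iota_uniq|].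
by rewrite mem_index_iota => q_range q_pr; apply: prime_dvd_bin_large; lia.
Qed.

Lemma central_bin_ge (m : nat) : 0 < m -> 4 ^ m <= 2 * m * 'C(2 * m, m).
Proof.
case: m => // m _; elim: m => [|m IHm]; first by vm_compute.
have diag := mul_bin_diag (2 * m.+2) m.+1.
have down := mul_bin_down (2 * m.+1 + 1) m.+1.
rewrite (_ : (2 * m.+2).-1 = 2 * m.+1 + 1) in diag; last lia.
rewrite (_ : (2 * m.+1 + 1).-1 = 2 * m.+1) in down; last lia.
rewrite (_ : 2 * m.+1 + 1 - m.+1 = m.+2) in down; last lia.
rewrite expnS; nia.
Qed.

(* A prime [q] below [p] but above both [s] and [2m / 3] does not divide
   ['C(2m, m)]. *)
Lemma partn_central_bin_le (m p s q : nat) (n := 2 * m) : 2 < p -> p <= m ->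
  n < s.+1 ^ 2 -> prime q ->
  'C(n, m)`_q <= n ^ (q <= s) * q ^ (q <= minn p.-1 (n %/ 3)) * n ^ (p <= q).
Proof.
move=> p_gt2 p_m n_s q_pr; have q_gt0 := prime_gt0 q_pr.
have n_gt0 : 0 < n by rewrite /n; lia.
have m_n : m <= n by rewrite /n; lia.
have part_le := partn_bin_le q_pr n_gt0 m_n.
have [q_s|s_q] := leqP q s.
  rewrite -mulnA expn1 (leq_trans part_le) // leq_pmulr //.
  by rewrite muln_gt0 !expn_gt0 n_gt0 q_gt0.
have [p_q|q_p] := leqP p q.
  rewrite expn1 (leq_trans part_le) // leq_pmull //.
  by rewrite muln_gt0 !expn_gt0 n_gt0 q_gt0.
rewrite !expn0 mul1n muln1; have [q_y|y_q] := leqP q _.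
  rewrite expn1 partn_bin_le_prime //.
  by apply: leq_trans n_s _; rewrite leq_exp2r.
rewrite partn_central_bin_eq1 //; move: y_q; rewrite gtn_min ltn_divLR // /n.
all: by lia.
Qed.

Lemma central_bin_le (m p s : nat) (n := 2 * m) : 2 < p -> p <= m ->
  n < s.+1 ^ 2 ->
  'C(n, m) <= n ^ (s + prime_count p n.+1) * 4 ^ minn p.-1 (n %/ 3).
Proof.
move=> p_gt2 p_m n_s; set y := minn _ _.
have n_gt0 : 0 < n by rewrite /n; lia.
rewrite bin_prod_partn; last by rewrite /n; lia.
apply: (@leq_trans (\prod_(0 <= q < n.+1 | prime q)
    (n ^ (q <= s) * q ^ (q <= y) * n ^ (p <= q)))).
  by apply: leq_prod => q; apply: partn_central_bin_le.
rewrite !big_split /= -!expn_sum expnD mulnAC leq_mul //; last first.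
  apply: leq_trans (leq_primorial y).
  rewrite /primorial [leqRHS](big_nat_widen _ _ n.+1); last by rewrite /y; lia.
  rewrite [leqRHS]big_mkcondr; apply: leq_prod => q _.
  by rewrite ltnS; case: (leqP q y).
rewrite leq_mul ?leq_pexp2l //.
  apply: leq_trans (sum_leq_indicator_le n.+1 s).
  by rewrite big_mkcond big_ltn //; apply: leq_sum => q _; case: ifP.
rewrite /prime_count -sum1_count (big_nat_widenl p 0) // big_mkcondr.
by apply: leq_sum => q _; case: (leqP p q).
Qed.

Lemma chebyshev_lower (m p s L : nat) (n := 2 * m) : 2 < p -> p <= m ->
  n < s.+1 ^ 2 -> n <= 2 ^ L ->
  n <= 2 * minn p.-1 (n %/ 3) + L * (s + (prime_count p n.+1).+1).
Proof.
move=> p_gt2 p_m n_s n_L; set y := minn _ _; set D := prime_count _ _.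
have m_gt0 : 0 < m by lia.
rewrite -(leq_exp2l (m := 2)) // expnD !(expnM 2) -/(4).
apply: leq_trans (central_bin_ge m_gt0) _.
apply: leq_trans (leq_mul (leqnn n) (central_bin_le p_gt2 p_m n_s)) _.
rewrite mulnA -expnS mulnC leq_mul // addnS.
by rewrite leq_exp2r.
Qed.

(** * The Eratosthenes-Legendre sieve *)

Local Open Scope ring_scope.

Section Sieve.

Variable F : realFieldType.

Definition sieve_density (x : nat) : F :=
  \prod_(0 <= q < x | prime q) (1 - q%:R^-1).

(* Buchstab's identity turns [N %/ d] into [N %/ (d * q)]: sieving by [q] needs
   the bound at all the quotients of [N]. *)
Definition sieve_error_le (x : nat) (E : F) : Prop :=
  forall N d : nat, (0 < d)%N ->
  `|(rough_count x (N %/ d))%:R - sieve_density x * (N%:R / d%:R)| <= E.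

Lemma sieve_densityS (x : nat) :
  sieve_density x.+1 = sieve_density x * (if prime x then 1 - x%:R^-1 else 1).
Proof.
by rewrite /sieve_density big_mkcond big_nat_recr //= -big_mkcond.
Qed.

Lemma sieve_density_ge0 (x : nat) : 0 <= sieve_density x.
Proof.
apply: prodr_ge0 => q /prime_gt0 q_gt0.
by rewrite subr_ge0 invf_le1 ?ler1n ?ltr0n.
Qed.

Lemma sieve_error_prime (x : nat) (E : F) : prime x ->
  sieve_error_le x E -> sieve_error_le x.+1 (2 * E).
Proof.
move=> x_pr err_x N d d_gt0; have x_gt0 := prime_gt0 x_pr.
have err_d := err_x N d d_gt0.
have := err_x N (d * x)%N; rewrite muln_gt0 d_gt0 => /(_ x_gt0) err_dx.
have := rough_count_prime_split (N %/ d) x_pr; rewrite -divnMA.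
move=> /(congr1 (fun c => c%:R : F)); rewrite natrD => countE.
rewrite sieve_densityS x_pr [2 * E]mulr_natl mulr2n.
have -> : (rough_count x.+1 (N %/ d))%:R
            - sieve_density x * (1 - x%:R^-1) * (N%:R / d%:R) =
    ((rough_count x (N %/ d))%:R - sieve_density x * (N%:R / d%:R))
    - ((rough_count x (N %/ (d * x)))%:R
       - sieve_density x * (N%:R / (d * x)%:R)).
  by rewrite countE natrM invfM; ring.
exact: le_trans (ler_normB _ _) (lerD err_d err_dx).
Qed.

Lemma sieve_error_not_prime (x : nat) (E : F) : ~~ prime x ->
  sieve_error_le x E -> sieve_error_le x.+1 E.
Proof.
move=> xNpr err_x N d d_gt0; rewrite sieve_densityS (negPf xNpr) mulr1.
by rewrite rough_count_not_prime //; apply: err_x.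
Qed.

Lemma sieve_error_widen (x y : nat) (E : F) : (x <= y)%N ->
  sieve_error_le x E -> sieve_error_le y (2 ^+ prime_count x y * E).
Proof.
move=> /subnKC <- err_x; elim: (y - x)%N => [|i IHi].
  by rewrite addn0 /prime_count /index_iota subnn mul1r.
rewrite addnS prime_countS ?leq_addr //.
have [x_pr|xNpr] := boolP (prime (x + i)); last first.
  by rewrite addn0; apply: sieve_error_not_prime.
by rewrite addn1 exprS -mulrA; apply: sieve_error_prime.
Qed.

Lemma sieve_error7 : sieve_error_le 7 1.
Proof.
move=> N d d_gt0; have d_gt0F : 0 < d%:R :> F by rewrite ltr0n.
have -> : sieve_density 7 = 4 / 15.
  by rewrite /sieve_density unlock /=; field.
have [upper lower] := rough_count7_bounds (N %/ d).
have quot_le : (N %/ d)%:R <= N%:R / d%:R :> F.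
  by rewrite ler_pdivlMr // -natrM ler_nat leq_divM.
have quot_gt : N%:R / d%:R <= (N %/ d)%:R + 1 :> F.
  by rewrite ler_pdivrMr // natr1 -natrM ler_nat ltnW // ltn_ceil.
have {}upper : 15 * (rough_count 7 (N %/ d))%:R <= 4 * (N %/ d)%:R + 14 :> F.
  by rewrite -!natrM -natrD ler_nat.
have {}lower : 4 * (N %/ d)%:R <= 15 * (rough_count 7 (N %/ d))%:R + 10 :> F.
  by rewrite -!natrM -natrD ler_nat.
rewrite ler_norml; lra.
Qed.

(* [(x + 2) (1 - 1/x) >= x] compensates the factor of at most one prime. *)
Lemma leq_sieve_density_odd (x y : nat) : odd x -> odd y -> (1 < x <= y)%N ->
  x%:R * sieve_density x <= y%:R * sieve_density y.
Proof.
move=> x_odd y_odd /andP[x_gt1 x_y].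
have [i ->] : exists i, y = (x + i.*2)%N by exists ((y - x)./2); lia.
elim: i => [|i IHi]; first by rewrite addn0.
apply: le_trans IHi _; rewrite doubleS !addnS.
have : odd (x + i.*2) by lia.
have : (1 < x + i.*2)%N by lia.
move: (x + i.*2)%N => {x_odd x_gt1 x_y}x x_gt1 x_odd.
have xSNpr : prime x.+1 = false by apply/negP => /even_prime[|]; lia.
have x_ge2 : 2 <= x%:R :> F by rewrite (ler_nat F 2).
have x_inv : x%:R * x%:R^-1 = 1 :> F by rewrite divff // gt_eqF; lra.
have inv_le : x%:R^-1 <= 2^-1 :> F by rewrite lef_pV2 ?posrE; lra.
rewrite sieve_densityS xSNpr mulr1 sieve_densityS [leLHS]mulrC [leRHS]mulrCA.
rewrite ler_wpM2l ?sieve_density_ge0 // -addn2 natrD.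
by case: ifP => _; lra.
Qed.

Lemma rough_count_ge_sieve (c : F) (x N : nat) : (6 < x)%N ->
  c <= x%:R * sieve_density x ->
  c * N%:R <= x%:R * ((rough_count x N)%:R + 2 ^+ prime_count 7 x).
Proof.
move=> x_gt6 c_le.
have := sieve_error_widen x_gt6 sieve_error7 N (isT : (0 < 1)%N).
rewrite mulr1 divn1 divr1 ler_norml => /andP[error_ge _].
apply: le_trans (ler_wpM2r (ler0n _ N) c_le) _.
by rewrite -mulrA ler_wpM2l //; lra.
Qed.

End Sieve.

Lemma rough_count_gt_sieve (a x N : nat) : (6 < x)%N ->
  a%:R <= 2 * (x%:R * sieve_density rat x) ->
  (2 * (2 * N + 1 + x * 2 ^ prime_count 7 x) < a * N)%N ->
  (2 * N + 1 < x * rough_count x N)%N.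
Proof.
move=> x_gt6 a_le N_large.
have half_le : a%:R / 2 <= x%:R * sieve_density rat x by lra.
have := rough_count_ge_sieve N x_gt6 half_le.
have -> : a%:R / 2 * N%:R = (a * N)%:R / 2 :> rat by rewrite natrM; ring.
rewrite ler_pdivrMr // -natrX -natrD -!natrM ler_nat; lia.
Qed.

Lemma sieve_density_ge_11 (x : nat) : odd x -> (11 <= x)%N ->
  5%:R <= 2 * (x%:R * sieve_density rat x).
Proof.
move=> x_odd x_ge; have := @leq_sieve_density_odd rat 11 x isT x_odd x_ge.
by rewrite {1}/sieve_density unlock /=; lra.
Qed.

Lemma sieve_density_ge_29 (x : nat) : odd x -> (29 <= x)%N ->
  9%:R <= 2 * (x%:R * sieve_density rat x).
Proof.
move=> x_odd x_ge; have := @leq_sieve_density_odd rat 29 x isT x_odd x_ge.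
by rewrite {1}/sieve_density unlock /=; lra.
Qed.

(** * The three regimes *)

Local Open Scope nat_scope.

Lemma expn2_gt_linear (j : nat) : 5 <= j -> 4 * j.+1 < 2 ^ j.
Proof.
move=> /subnKC <-; elim: (j - 5) => [|i IHi]; first by [].
by rewrite addnS expnS; move: (2 ^ _) IHi => E; lia.
Qed.

Lemma expn2_ge_square (j : nat) : 12 <= j -> (24 * j.+1) ^ 2 <= 25 * 2 ^ j.
Proof.
move=> /subnKC <-; elim: (j - 12) => [|i IHi]; first by vm_compute.
rewrite addnS [2 ^ _]expnS [25 * _]mulnCA.
apply: leq_trans (leq_mul (leqnn 2) IHi).
by rewrite !expnMn [2 * _]mulnCA leq_mul2l -!mulnn; nia.
Qed.

(* The last hypothesis says that the sieve fails at [N]. *)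
Lemma trunc_log_below_sieve_range (p e N : nat) :
  41 <= p -> 15 * e <= 4 * p - 5 -> 5 * N <= 2 * (1 + p * 2 ^ e) ->
  8 * (trunc_log 2 N).+1 <= 3 * p.
Proof.
move=> p_ge e_le N_le; have [->|N_gt0] := posnP N.
  by rewrite trunc_log0; lia.
set L := trunc_log 2 N; have L_N : 2 ^ L <= N by apply: trunc_logP.
have L_le : 5 * 2 ^ L <= 2 * p.+1 * 2 ^ e.
  have : 0 < 2 ^ e by rewrite expn_gt0.
  by move: (2 ^ e) N_le => E; nia.
have L_lt t : 2 * p.+1 < 5 * 2 ^ t -> L < t + e.
  move=> p_lt; rewrite -(ltn_exp2l (m := 2)) // -(ltn_pmul2l (isT : 0 < 5)).
  apply: leq_ltn_trans L_le _.
  by rewrite expnD mulnA ltn_pmul2r ?expn_gt0.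
have [p_lt|p_ge64] := ltnP p 64; first by have := L_lt 5; lia.
have p_lt_expn : 4 * (p %/ 10).+1 < 2 ^ (p %/ 10).
  by apply: expn2_gt_linear; lia.
by have := L_lt (p %/ 10); lia.
Qed.

Lemma trunc_log_le_sqrt (N s : nat) : 4096 <= N -> N <= s.+1 ^ 2 ->
  24 * (trunc_log 2 N).+1 <= 5 * s.+1.
Proof.
move=> N_ge N_le; rewrite -(@leq_exp2r _ _ 2) // [leqRHS]expnMn.
have log_ge : 12 <= trunc_log 2 N by apply: trunc_log_max.
apply: leq_trans (expn2_ge_square log_ge) _; rewrite leq_mul2l /=.
by apply: leq_trans N_le; apply: trunc_logP; lia.
Qed.

Lemma prime_count_gt_large (p N : nat) : 41 <= p -> 2 * p <= N -> 4096 <= N ->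
  8 * (trunc_log 2 N).+1 <= 3 * p -> 2 * N + 1 < p * (prime_count p N.+1).+1.
Proof.
move=> p_ge N_ge2p N_ge; set L := (trunc_log 2 N).+1 => L_p.
set k := (prime_count p N.+1).+1; rewrite ltnNge; apply/negP => pk_le.
set n := 2 * N./2; have n_N : n <= N <= n.+1 by rewrite /n; lia.
set s := Nat.sqrt n; have [s_le s_gt] : s * s <= n /\ n < s.+1 * s.+1.
  by have := Nat.sqrt_spec' n; lia.
have s_ge : 64 <= s by nia.
have log_gt : N < 2 ^ L by apply: trunc_log_ltn.
have L_s : 24 * L <= 5 * s.+1.
  by apply: trunc_log_le_sqrt => //; rewrite -mulnn; lia.
have n_le : n <= 2 * minn p.-1 (n %/ 3) + L * (s + k).
  apply: leq_trans (@chebyshev_lower N./2 p s L _ _ _ _) _.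
  - by lia.
  - by lia.
  - by rewrite -mulnn.
  - by lia.
  by rewrite leq_add2l leq_mul2l leq_add2l ltnS leq_prime_count ?orbT //; lia.
rewrite mulnDr in n_le.
have s_share : 64 * s <= n.
  by apply: leq_trans s_le; rewrite leq_mul2r s_ge orbT.
have Ls_share : 24 * (L * s) <= 5 * (n + s).
  by have := leq_mul L_s (leqnn s); lia.
have p_gt0 : 0 < p by lia.
(* The shares of [2 y], [L * s] and [L * k] in [n] are at most about
   2/3 + 0.21 + 0.11 for [N < 16 p], then 1/8 + 0.21 + 0.42 for [N < 64 p],
   and 1/32 + 0.21 + 3/4 beyond. *)
have [N_lt16p|N_ge16p] := ltnP N (16 * p).
  have k_le : k <= 32 by rewrite -(leq_pmul2l p_gt0); lia.
  by have := leq_mul L_s k_le; lia.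
have [N_lt64p|N_ge64p] := ltnP N (64 * p).
  have k_le : k <= 128 by rewrite -(leq_pmul2l p_gt0); lia.
  by have := leq_mul L_s k_le; lia.
by have := leq_mul L_p (leqnn k); lia.
Qed.

Lemma sieve_threshold_check (p : nat) : prime p -> 11 <= p < 41 ->
  2 * (1 + p * 2 ^ prime_count 7 p) <
  (if p < 31 then 1 else 5) * computed_range p.
Proof.
move=> p_pr p_range; suff: all (fun p => prime p ==>
    (2 * (1 + p * 2 ^ prime_count 7 p) <
     (if p < 31 then 1 else 5) * computed_range p)) (iota 11 30).
  by move/allP/(_ p); rewrite mem_iota p_pr; apply.
by vm_compute.
Qed.

Lemma rough_count_gt (p N : nat) : prime p -> 11 <= p -> 2 * p <= N ->
  2 * N + 1 < p * rough_count p N.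
Proof.
move=> p_pr p_ge N_ge; have p_odd : odd p by case: (even_prime p_pr) => //; lia.
have from_primes : 2 * N + 1 < p * (prime_count p N.+1).+1 ->
    2 * N + 1 < p * rough_count p N.
  move=> /leq_trans; apply.
  by rewrite leq_mul2l prime_count_lt_rough_count ?orbT //; lia.
have [N_lt|N_ge_range] := ltnP N (computed_range p).
  exact/from_primes/prime_count_gt_small.
have [p_lt31|p_ge31] := ltnP p 31.
  apply: (@rough_count_gt_sieve 5); [lia|exact: sieve_density_ge_11|].
  by have := sieve_threshold_check p_pr; rewrite p_lt31; lia.
have [N_large|N_le] := ltnP (2 * (2 * N + 1 + p * 2 ^ prime_count 7 p)) (9 * N).
  apply: (rough_count_gt_sieve _ _ N_large); first lia.
  by apply: sieve_density_ge_29; lia.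
have [p_lt41|p_ge41] := ltnP p 41.
  by have := sieve_threshold_check p_pr; rewrite [p < 31]ltnNge p_ge31 /=; lia.
apply/from_primes/prime_count_gt_large => //.
  by move: N_ge_range; rewrite /computed_range; case: ifP; lia.
by apply: trunc_log_below_sieve_range (prime_count7_le _) _; lia.
Qed.

Lemma Phi_rough_count (R : realType) (x : R) (p : nat) :
  Phi x p%:R = rough_count p (Num.truncn x).
Proof.
by apply: eq_count => k; apply: eq_all => q; rewrite ltr_nat -leqNgt.
Qed.

Local Open Scope ring_scope.

Theorem theorem1p1 (R : realType) (p : nat) (n : R)
    (p_prime : prime p) (p_ge11 : (11 <= p)%N) (n_ge : 2 * p%:R <= n) :
  Num.floor (2 * n / p%:R) + 1 <= (Phi n p%:R)%:Z.
Proof.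
rewrite Phi_rough_count; set N := Num.truncn n.
have p_gt0 : 0 < p%:R :> R by rewrite ltr0n prime_gt0.
have n_ge0 : 0 <= n by rewrite (le_trans _ n_ge) // mulr_ge0.
have N_ge : (2 * p <= N)%N by rewrite truncn_ge_nat // natrM.
have : (2 * N.+1 <= p * rough_count p N)%N.
  by have := rough_count_gt p_prime p_ge11 N_ge; lia.
rewrite -(ler_nat R) !natrM => count_ge.
rewrite lezD1 floor_lt_int -[_%:~R]/((rough_count p N)%:R) ltr_pdivrMr //.
by have := truncnS_gt n; rewrite -/N; lra.
Qed.
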